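(* For every GKAT expression $e\in\mathrm{Exp}$, the Thompson automaton $\mathcal{X}_e^\iota$ for $e$ recognizes $[\![e]\!]$, that is, $\ell^{\mathcal{X}_e^\iota}(\iota)=[\![e]\!]$.
   Context: Syntax. Fix disjoint nonempty sets $\Sigma$ (actions) and $T=\{t_1,\dots,t_n\}$ (primitive tests), $T$ finite. Boolean expressions $b,c\in\mathrm{BExp}$ are generated by $0 \mid 1 \mid t\in T \mid b\cdot c \mid b+c \mid \overline{b}$. GKAT expressions $e,f\in\mathrm{Exp}$ are generated by $p\in\Sigma \mid b\in\mathrm{BExp} \mid e\cdot f \mid e+_b f \mid e^{(b)}$. $\equiv_{BA}$ denotes Boolean equivalence, $b\le c$ iff $b+c\equiv_{BA}c$. $\mathrm{At}$ is the finite set of atoms (minimal nonzero elements) of the free Boolean algebra $\mathrm{BExp}/{\equiv_{BA}}$ on $T$. Language model. Guarded strings: $\mathrm{GS}=\mathrm{At}\cdot(\Sigma\cdot\mathrm{At})^*$. Fusion product: $x\alpha\diamond\beta y = x\alpha y$ if $\alpha=\beta$, undefined otherwise; for $L,K\subseteq\mathrm{GS}$, $L\diamond K=\{x\diamond y : x\in L,y\in K, x\diamond y\text{ defined}\}$; $L^0=\mathrm{At}$, $L^{n+1}=L^n\diamond L$. For $B\subseteq\mathrm{At}$, $\overline{B}=\mathrm{At}\setminus B$, $L+_BK=(B\diamond L)\cup(\overline{B}\diamond K)$, $L^{(B)}=\bigcup_{n\ge0}(B\diamond L)^n\diamond\overline{B}$. Then $[\![-]\!]:\mathrm{Exp}\to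 2^{\mathrm{GS}}$ is: $[\![p]\!]=\{\alpha p\beta:\alpha,\beta\in\mathrm{At}\}$, $[\![b]\!]=\{\alpha\in\mathrm{At}:\alpha\le b\}$, $[\![e\cdot f]\!]=[\![e]\!]\diamond[\![f]\!]$, $[\![e+_bf]\!]=[\![e]\!]+_{[\![b]\!]}[\![f]\!]$, $[\![e^{(b)}]\!]=[\![e]\!]^{([\![b]\!])}$. Automata. Let $GX=(2+\Sigma\times X)^{\mathrm{At}}$ with $2=\{0,1\}$. A $G$-coalgebra is a pair $\mathcal{X}=\langle X,\delta^{\mathcal{X}}\rangle$ with $\delta^{\mathcal{X}}:X\to GX$; a $G$-automaton is a $G$-coalgebra with a designated start state. The language $\ell^{\mathcal{X}}(s)\subseteq\mathrm{GS}$ of a state $s$ is defined inductively: $\alpha\in\ell^{\mathcal{X}}(s)$ iff $\delta^{\mathcal{X}}(s)(\alpha)=1$; $\alpha px\in\ell^{\mathcal{X}}(s)$ iff $\delta^{\mathcal{X}}(s)(\alpha)=(p,t)$ for some $t$ with $x\in\ell^{\mathcal{X}}(t)$. Thompson construction. For $\langle X,\delta\rangle$, $Y\subseteq X$, $h\in GX$, the uniform continuation $\delta[Y,h]:X\to GX$ is $\delta[Y,h](x)(\alpha)=h(\alpha)$ if $x\in Y$ and $\delta(x)(\alpha)=1$, and $\delta[Y,h](x)(\alpha)=\delta(x)(\alpha)$ otherwise. $\delta_1+\delta_2$ denotes the coproduct structure on the disjoint union $X+Y$. For each $e\in\mathrm{Exp}$ define a $G$-coalgebra $\mathcal{X}_e=\langle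 X_e,\delta_e\rangle$ and an initial pseudostate $\iota_e\in GX_e$ by recursion: - $e=b$: $X_b=\emptyset$, $\iota_b(\alpha)=1$ if $\alpha\le b$, else $0$. - $e=p$: $X_p=\{*\}$, $\delta_p( * )(\alpha)=1$ for all $\alpha$, $\iota_p(\alpha)=(p,* )$. - $e=f+_bg$: $X_e=X_f+X_g$, $\delta_e=\delta_f+\delta_g$, $\iota_e(\alpha)=\iota_f(\alpha)$ if $\alpha\le b$, $\iota_g(\alpha)$ if $\alpha\le\overline{b}$. - $e=f\cdot g$: $X_e=X_f+X_g$, $\delta_e=(\delta_f+\delta_g)[X_f,\iota_g]$, $\iota_e(\alpha)=\iota_f(\alpha)$ if $\iota_f(\alpha)\ne1$, $\iota_g(\alpha)$ if $\iota_f(\alpha)=1$. - $e=f^{(b)}$: $X_e=X_f$, $\iota_e(\alpha)=1$ if $\alpha\le\overline{b}$; $0$ if $\alpha\le b$ and $\iota_f(\alpha)=1$; $\iota_f(\alpha)$ if $\alpha\le b$ and $\iota_f(\alpha)\ne1$; $\delta_e=\delta_f[X_f,\iota_e]$. The Thompson automaton is $\mathcal{X}_e^\iota=\langle\{\iota\}+X_e,\delta_e^\iota,\iota\rangle$ with $\delta_e^\iota(x)=\delta_e(x)$ for $x\in X_e$ and $\delta_e^\iota(\iota)=\iota_e$. *)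

(* Defs.v *)
From HB Require Import structures.
From Stdlib Require Import Setoid.
From mathcomp Require Import all_boot.
From mathcomp Require Import boolp classical_sets.

Set Implicit Arguments.
Unset Strict Implicit.
Unset Printing Implicit Defensive.

Local Open Scope classical_set_scope.
Local Open Scope quotient_scope.

Inductive bexp (T : finType) : Type :=
| BZero
| BOne
| BTest (t : T)
| BAnd (b c : bexp T)
| BOr (b c : bexp T)
| BNot (b : bexp T).

Arguments BZero {T}.
Arguments BOne {T}.

Inductive exp (Sigma : Type) (T : finType) : Type :=
| EAct (p : Sigma)
| ETest (b : bexp T)
| ESeq (e f : exp Sigma T)
| EIte (b : bexp T) (e f : exp Sigma T)
| EWhile (b : bexp T) (e : exp Sigma T).

Arguments ETest {Sigma T}.

(* Boolean equivalence: the least congruence satisfying the axioms of Boolean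
   algebra, so that bexp T modulo beq is the free Boolean algebra on T. *)
Inductive beq (T : finType) : bexp T -> bexp T -> Prop :=
| beq_refl b : beq b b
| beq_sym b c : beq b c -> beq c b
| beq_trans b c d : beq b c -> beq c d -> beq b d
| beq_and b b' c c' : beq b b' -> beq c c' -> beq (BAnd b c) (BAnd b' c')
| beq_or b b' c c' : beq b b' -> beq c c' -> beq (BOr b c) (BOr b' c')
| beq_not b b' : beq b b' -> beq (BNot b) (BNot b')
| beq_andA b c d : beq (BAnd b (BAnd c d)) (BAnd (BAnd b c) d)
| beq_orA b c d : beq (BOr b (BOr c d)) (BOr (BOr b c) d)
| beq_andC b c : beq (BAnd b c) (BAnd c b)
| beq_orC b c : beq (BOr b c) (BOr c b)
| beq_andDr b c d : beq (BAnd b (BOr c d)) (BOr (BAnd b c) (BAnd b d))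
| beq_orDr b c d : beq (BOr b (BAnd c d)) (BAnd (BOr b c) (BOr b d))
| beq_and1 b : beq (BAnd b BOne) b
| beq_or0 b : beq (BOr b BZero) b
| beq_andN b : beq (BAnd b (BNot b)) BZero
| beq_orN b : beq (BOr b (BNot b)) BOne.

Definition ble (T : finType) (b c : bexp T) : Prop := beq (BOr b c) c.

HB.instance Definition _ (T : finType) := gen_eqMixin (bexp T).
HB.instance Definition _ (T : finType) := gen_choiceMixin (bexp T).

Definition beqb (T : finType) : rel (bexp T) := fun b c => `[< beq b c >].

Lemma beqb_equiv (T : finType) : equiv_class_of (@beqb T).
Proof.
split=> [b|b c|c b d].
- by apply/asboolP; exact: beq_refl.
- by apply/asboolP/asboolP; exact: beq_sym.
- by move=> /asboolP bc /asboolP cd; apply/asboolP; exact: beq_trans bc cd.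
Qed.

Canonical beqb_equivRel (T : finType) := EquivRelPack (@beqb_equiv T).

Definition freeBA (T : finType) := {eq_quot (@beqb_equivRel T)}.

HB.instance Definition _ (T : finType) := EqQuotient.on (freeBA T).

Definition bclass (T : finType) (b : bexp T) : freeBA T := \pi_(freeBA T) b.

Definition le_BA (T : finType) (x y : freeBA T) : Prop :=
  ble (repr x) (repr y).

Lemma repr_bclass (T : finType) (b : bexp T) : beq (repr (bclass b)) b.
Proof.
apply/asboolP; change (beqb_equivRel T (repr (bclass b)) b).
by rewrite -eqmodE reprK.
Qed.

Lemma bclassE (T : finType) (b c : bexp T) : bclass b = bclass c <-> beq b c.
Proof.
split=> [bc|/asboolP bc]; last by apply/eqP; rewrite /bclass eqmodE.
by apply: beq_trans (repr_bclass c); rewrite -bc; apply/beq_sym/repr_bclass.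
Qed.

(* le_BA does not depend on the chosen representatives. *)
Lemma le_BAE (T : finType) (b c : bexp T) :
  le_BA (bclass b) (bclass c) <-> ble b c.
Proof.
have H b1 b2 c1 c2 : beq b1 b2 -> beq c1 c2 -> ble b1 c1 -> ble b2 c2.
  move=> hb hc h; apply: beq_trans (beq_trans h hc).
  by apply: beq_or; exact: beq_sym.
by split; apply: H; (exact: repr_bclass || apply/beq_sym/repr_bclass).
Qed.

Definition is_atom (T : finType) (x : freeBA T) : bool :=
  `[< x <> bclass BZero /\
      forall y : freeBA T, y <> bclass BZero -> le_BA y x -> y = x >].

Definition At (T : finType) := {x : freeBA T | is_atom x}.

Definition below (T : finType) (a : At T) (b : bexp T) : bool :=
  `[< le_BA (val a) (bclass b) >].

Lemma belowE (T : finType) (a : At T) (d b : bexp T) :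
  val a = bclass d -> below a b <-> ble d b.
Proof.
move=> ad; rewrite /below ad; split=> [/asboolP/le_BAE //|db].
by apply/asboolP/le_BAE.
Qed.

Add Parametric Relation (T : finType) : (bexp T) (@beq T)
  reflexivity proved by (@beq_refl T)
  symmetry proved by (@beq_sym T)
  transitivity proved by (@beq_trans T) as beq_rel.

Add Parametric Morphism (T : finType) : (@BAnd T)
  with signature (@beq T) ==> (@beq T) ==> (@beq T) as BAnd_mor.
Proof. by move=> *; exact: beq_and. Qed.

Add Parametric Morphism (T : finType) : (@BOr T)
  with signature (@beq T) ==> (@beq T) ==> (@beq T) as BOr_mor.
Proof. by move=> *; exact: beq_or. Qed.

Lemma below_not (T : finType) (a : At T) (b : bexp T) :
  below a (BNot b) = ~~ below a b.
Proof.
have and0 (x : bexp T) : beq (BAnd x BZero) BZero.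
  setoid_rewrite <- (beq_or0 (BAnd x BZero)).
  setoid_rewrite <- (beq_andN x) at 2.
  setoid_rewrite <- (beq_andDr x BZero (BNot x)).
  setoid_rewrite (beq_orC BZero (BNot x)).
  setoid_rewrite (beq_or0 (BNot x)).
  exact: beq_andN.
have or1 (x : bexp T) : beq (BOr x BOne) BOne.
  setoid_rewrite <- (beq_and1 (BOr x BOne)).
  setoid_rewrite <- (beq_orN x) at 2.
  setoid_rewrite <- (beq_orDr x BOne (BNot x)).
  setoid_rewrite (beq_andC BOne (BNot x)).
  setoid_rewrite (beq_and1 (BNot x)).
  exact: beq_orN.
have orK (x y : bexp T) : beq (BOr x (BAnd x y)) x.
  setoid_rewrite <- (beq_and1 x) at 1.
  setoid_rewrite <- (beq_andDr x BOne y).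
  setoid_rewrite (beq_orC BOne y).
  setoid_rewrite (or1 y).
  exact: beq_and1.
have andK (x y : bexp T) : beq (BAnd x (BOr x y)) x.
  setoid_rewrite <- (beq_or0 x) at 1.
  setoid_rewrite <- (beq_orDr x BZero y).
  setoid_rewrite (beq_andC BZero y).
  setoid_rewrite (and0 y).
  exact: beq_or0.
pose d := repr (val a).
have ad : val a = bclass d by rewrite /bclass reprK.
have [d0 dmin] := elimT (asboolP _) (valP a).
have {}d0 : ~ beq d BZero by move=> h; apply: d0; rewrite ad; apply/bclassE.
have {}dmin c : ~ beq c BZero -> ble c d -> beq c d.
  move=> c0 cd; apply/bclassE; rewrite -ad; apply: dmin.
    by move/bclassE.
  by rewrite ad; apply/le_BAE.
have meetE (c : bexp T) : ble d c -> beq (BAnd d c) d.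
  by move=> dc; exact: beq_trans (beq_and (beq_refl d) (beq_sym dc)) (andK d c).
apply/idP/idP => [/(belowE _ ad) dNb|/negP ndb].
  apply/negP => /(belowE _ ad) db; apply: d0.
  setoid_rewrite <- (meetE _ db).
  setoid_rewrite <- (meetE _ dNb).
  setoid_rewrite <- (beq_andA d (BNot b) b).
  setoid_rewrite (beq_andC (BNot b) b).
  setoid_rewrite (beq_andN b).
  exact: and0.
apply/(belowE _ ad); rewrite /ble.
have [db0|db0] := pselect (beq (BAnd d b) BZero).
  setoid_rewrite (beq_orC d (BNot b)).
  setoid_rewrite <- (beq_and1 (BOr (BNot b) d)).
  setoid_rewrite <- (beq_orN b).
  setoid_rewrite (beq_orC b (BNot b)).
  setoid_rewrite <- (beq_orDr (BNot b) d b).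
  setoid_rewrite db0.
  exact: beq_or0.
case: ndb; apply/(belowE _ ad); rewrite /ble.
have dbd : beq (BAnd d b) d.
  by apply: dmin => //; exact: (beq_trans (beq_orC _ _) (orK d b)).
setoid_rewrite <- dbd.
setoid_rewrite (beq_orC (BAnd d b) b).
setoid_rewrite (beq_andC d b).
exact: orK.
Qed.

(* At.(Sigma.At)^* : the pair (a, [:: (p1, a1); ...; (pk, ak)]) encodes the
   guarded string a p1 a1 ... pk ak. *)
Definition gstring (Sigma : Type) (T : finType) : Type :=
  (At T * seq (Sigma * At T))%type.

Definition gs_first Sigma T (x : gstring Sigma T) : At T := x.1.

Definition gs_last Sigma T (x : gstring Sigma T) : At T :=
  last x.1 (map snd x.2).

Definition fuse Sigma T (x y : gstring Sigma T) : option (gstring Sigma T) :=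
  if gs_last x == gs_first y then Some (x.1, x.2 ++ y.2) else None.

Definition lfuse Sigma T (L K : set (gstring Sigma T)) :
    set (gstring Sigma T) :=
  [set z | exists x y, [/\ L x, K y & fuse x y = Some z]].

(* A set of atoms viewed as a set of guarded strings. *)
Definition atoms_lang Sigma T (B : set (At T)) : set (gstring Sigma T) :=
  [set (a, [::]) | a in B].

Arguments atoms_lang Sigma {T} B.

Fixpoint lpow Sigma T (L : set (gstring Sigma T)) (n : nat) :
    set (gstring Sigma T) :=
  if n is m.+1 then lfuse (lpow L m) L else atoms_lang Sigma setT.

Definition lite Sigma T (B : set (At T)) (L K : set (gstring Sigma T)) :
    set (gstring Sigma T) :=
  lfuse (atoms_lang Sigma B) L `|` lfuse (atoms_lang Sigma (~` B)) K.

Definition lwhile Sigma T (B : set (At T)) (L : set (gstring Sigma T)) :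
    set (gstring Sigma T) :=
  \bigcup_n lfuse (lpow (lfuse (atoms_lang Sigma B) L) n)
                  (atoms_lang Sigma (~` B)).

Definition bsem T (b : bexp T) : set (At T) := [set a | below a b].

Fixpoint sem Sigma T (e : exp Sigma T) : set (gstring Sigma T) :=
  match e with
  | EAct p => [set x | exists a c : At T, x = (a, [:: (p, c)])]
  | ETest b => atoms_lang Sigma (bsem b)
  | ESeq f g => lfuse (sem f) (sem g)
  | EIte b f g => lite (bsem b) (sem f) (sem g)
  | EWhile b f => lwhile (bsem b) (sem f)
  end.

(* 2 + Sigma * X is bool + Sigma * X, with 1 encoded as inl true and 0 as
   inl false. *)
Definition G (Sigma : Type) (T : finType) (X : Type) : Type :=
  At T -> bool + Sigma * X.

Definition Gmap Sigma T (X Y : Type) (f : X -> Y) (h : G Sigma T X) :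
    G Sigma T Y :=
  fun a => match h a with
           | inl o => inl o
           | inr (p, x) => inr (p, f x)
           end.

Record coalgebra (Sigma : Type) (T : finType) := Coalgebra {
  state : Type;
  delta : state -> G Sigma T state }.

Record automaton (Sigma : Type) (T : finType) := Automaton {
  coalg :> coalgebra Sigma T;
  start : state coalg }.

Fixpoint accepts Sigma T (A : coalgebra Sigma T) (s : state A) (a : At T)
    (w : seq (Sigma * At T)) : Prop :=
  match w with
  | [::] => delta s a = inl true
  | (p, c) :: w' =>
      exists t : state A, delta s a = inr (p, t) /\ accepts t c w'
  end.

Definition lang Sigma T (A : coalgebra Sigma T) (s : state A) :
    set (gstring Sigma T) :=
  [set x | accepts s x.1 x.2].

Definition ucont Sigma T X (d : X -> G Sigma T X) (Y : set X)
    (h : G Sigma T X) : X -> G Sigma T X :=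
  fun x a => match d x a with
             | inl true => if x \in Y then h a else inl true
             | r => r
             end.

Definition coprod Sigma T X Y (d1 : X -> G Sigma T X) (d2 : Y -> G Sigma T Y) :
    X + Y -> G Sigma T (X + Y) :=
  fun z => match z with
           | inl x => Gmap inl (d1 x)
           | inr y => Gmap inr (d2 y)
           end.

Record pseudo (Sigma : Type) (T : finType) := Pseudo {
  pcoalg : coalgebra Sigma T;
  pinit : G Sigma T (state pcoalg) }.

Definition th_test Sigma T (b : bexp T) : pseudo Sigma T :=
  @Pseudo Sigma T
    (@Coalgebra Sigma T void (fun x => match x with end))
    (fun a => inl (below a b)).

Definition th_act Sigma T (p : Sigma) : pseudo Sigma T :=
  @Pseudo Sigma T
    (@Coalgebra Sigma T unit (fun _ _ => inl true))
    (fun _ => inr (p, tt)).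

(* By below_not, the else branch is exactly the case a <= ~b. *)
Definition th_ite Sigma T (b : bexp T) (F K : pseudo Sigma T) :
    pseudo Sigma T :=
  @Pseudo Sigma T
    (@Coalgebra Sigma T (state (pcoalg F) + state (pcoalg K))
       (coprod (@delta _ _ (pcoalg F)) (@delta _ _ (pcoalg K))))
    (fun a => if below a b then Gmap inl (pinit F) a
              else Gmap inr (pinit K) a).

Definition th_seq Sigma T (F K : pseudo Sigma T) : pseudo Sigma T :=
  @Pseudo Sigma T
    (@Coalgebra Sigma T (state (pcoalg F) + state (pcoalg K))
       (ucont (coprod (@delta _ _ (pcoalg F)) (@delta _ _ (pcoalg K)))
              (range inl) (Gmap inr (pinit K))))
    (fun a => match pinit F a with
              | inl true => Gmap inr (pinit K) a
              | _ => Gmap inl (pinit F) a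
              end).

Definition while_init Sigma T X (b : bexp T) (i : G Sigma T X) :
    G Sigma T X :=
  fun a => if below a b then
             match i a with
             | inl true => inl false
             | r => r
             end
           else inl true.

Definition th_while Sigma T (b : bexp T) (F : pseudo Sigma T) :
    pseudo Sigma T :=
  @Pseudo Sigma T
    (@Coalgebra Sigma T (state (pcoalg F))
       (ucont (@delta _ _ (pcoalg F)) setT (while_init b (pinit F))))
    (while_init b (pinit F)).

Fixpoint thompson Sigma T (e : exp Sigma T) : pseudo Sigma T :=
  match e with
  | EAct p => th_act T p
  | ETest b => th_test Sigma b
  | ESeq f g => th_seq (thompson f) (thompson g)
  | EIte b f g => th_ite b (thompson f) (thompson g)
  | EWhile b f => th_while b (thompson f)
  end.

Definition thompson_automaton Sigma T (e : exp Sigma T) : automaton Sigma T :=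
  @Automaton Sigma T
    (@Coalgebra Sigma T (unit + state (pcoalg (thompson e)))
       (fun z => match z with
                 | inl _ => Gmap inr (pinit (thompson e))
                 | inr x => Gmap inr (delta x)
                 end))
    (inl tt).

(* Main.v *)
(** Languages are attached to pseudostates, and the identity is proved for the
    initial pseudostate of each Thompson coalgebra by induction on the
    expression. The key fact is that if every state of a coalgebra continues
    uniformly with a pseudostate [k], then its language is the old one fused
    with the language of [k]. For a loop, [k] is the initial pseudostate itself:
    an iteration of the body that performs no action is either followed by
    another iteration from the same atom, and can then be dropped, or leads to
    rejection; so every accepted word splits into iterations that perform
    actions, and one inducts on its length. *)
Require Import Defs.
From HB Require Import structures.
From mathcomp Require Import all_boot.
From mathcomp Require Import boolp classical_sets.

Set Implicit Arguments.
Unset Strict Implicit.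
Unset Printing Implicit Defensive.

Local Open Scope classical_set_scope.

Section FusionProduct.
Variables (Sigma : Type) (T : finType).
Implicit Types (L K M : set (gstring Sigma T)) (B : set (At T)) (a : At T).

(** The shared atom is determined by the first factor, so the partial [fuse] can be traded for
    splitting a list. *)
Lemma lfuseP L K a w :
  lfuse L K (a, w) <->
  exists u v, [/\ w = u ++ v, L (a, u) & K (last a (map snd u), v)].
Proof.
split=> [[[a1 u] [[a2 v] [Lu Kv]]]|[u [v [-> Lu Kv]]]].
  rewrite /fuse /gs_last /=; case: eqP => //= e [<- <-].
  by exists u, v; split; rewrite // e.
by exists (a, u), (last a (map snd u), v); rewrite /fuse /gs_last eqxx.
Qed.

Lemma atoms_langP B a w : atoms_lang Sigma B (a, w) <-> B a /\ w = [::].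
Proof.
by split=> [[c Bc [<- <-]]|[Ba ->]] //; exists a.
Qed.

Lemma lfuse_atomsl B L a w :
  lfuse (atoms_lang Sigma B) L (a, w) <-> B a /\ L (a, w).
Proof.
split=> [/lfuseP[u [v [-> /atoms_langP[Ba ->]]]] //|[Ba Lw]].
by apply/lfuseP; exists [::], w; split=> //; apply/atoms_langP.
Qed.

Lemma lfuse1l L : lfuse (atoms_lang Sigma setT) L = L.
Proof. by apply/seteqP; split=> -[a w] => [/lfuse_atomsl[]|?] //; apply/lfuse_atomsl. Qed.

Lemma lfuse1r L : lfuse L (atoms_lang Sigma setT) = L.
Proof.
apply/seteqP; split=> -[a w].
  by move/lfuseP => [u [v [-> Lu /atoms_langP[_ ->]]]]; rewrite cats0.
by move=> Lw; apply/lfuseP; exists w, [::]; rewrite cats0; split=> //; apply/atoms_langP.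
Qed.

Lemma lfuseA L K M : lfuse L (lfuse K M) = lfuse (lfuse L K) M.
Proof.
apply/seteqP; split=> -[a w] /lfuseP[u [v [-> ]]].
  move=> Lu /lfuseP[v1 [v2 [-> Kv1 Mv2]]]; apply/lfuseP.
  exists (u ++ v1), v2; rewrite catA map_cat last_cat; split=> //.
  by apply/lfuseP; exists u, v1.
move=> /lfuseP[u1 [u2 [-> Lu1 Ku2]]]; rewrite map_cat last_cat => Mv.
apply/lfuseP; exists u1, (u2 ++ v); rewrite catA; split=> //.
by apply/lfuseP; exists u2, v.
Qed.

(** [lpow] grows on the right, whereas a run of a loop starts with its first iteration;
    associativity moves the extra factor to the left. *)
Lemma lpowSl L n : lpow L n.+1 = lfuse L (lpow L n).
Proof.
elim: n => [|n IHn]; first by rewrite /= lfuse1l lfuse1r.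
by rewrite -[LHS]/(lfuse (lpow L n.+1) L) {1}IHn -lfuseA.
Qed.

Lemma lwhile_stop B L a : ~ B a -> lwhile B L (a, [::]).
Proof.
move=> nBa; exists 0 => //=.
by rewrite lfuse1l; apply/atoms_langP.
Qed.

Lemma lwhile_step B L a u v :
  B a -> L (a, u) -> lwhile B L (last a (map snd u), v) ->
  lwhile B L (a, u ++ v).
Proof.
move=> Ba Lu [n _ nv]; exists n.+1 => //.
rewrite lpowSl -lfuseA; apply/lfuseP; exists u, v; split=> //.
by apply/lfuse_atomsl.
Qed.

Lemma lwhile_ind B L (P : At T -> seq (Sigma * At T) -> Prop) :
  (forall a, ~ B a -> P a [::]) ->
  (forall a u v, B a -> L (a, u) -> P (last a (map snd u)) v -> P a (u ++ v)) ->
  forall a w, lwhile B L (a, w) -> P a w.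
Proof.
move=> P0 PS a w [n _]; elim: n a w => [|n IHn] a w.
  by rewrite /= lfuse1l => /atoms_langP[nBa ->]; exact: P0.
rewrite lpowSl -lfuseA => /lfuseP[u [v [-> /lfuse_atomsl[Ba Lu] nv]]].
by apply: PS => //; exact: IHn.
Qed.

End FusionProduct.

(** Takes the value of a pseudostate at the first atom rather than the pseudostate, so that changes
    made atom by atom become rewriting of [r]. *)
Definition accepts_from Sigma T (A : coalgebra Sigma T)
    (r : bool + Sigma * state A) (w : seq (Sigma * At T)) : Prop :=
  match w with
  | [::] => r = inl true
  | (p, c) :: w' => exists t : state A, r = inr (p, t) /\ accepts t c w'
  end.

Definition pseudo_lang Sigma T (P : pseudo Sigma T) : set (gstring Sigma T) :=
  [set x | accepts_from (pinit P x.1) x.2].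

(** A uniform continuation seen at a single state and atom. *)
Definition oseq (Sigma X : Type) (r r' : bool + Sigma * X) :=
  if r is inl true then r' else r.

Section Pseudostates.
Variables (Sigma : Type) (T : finType).
Implicit Types A C : coalgebra Sigma T.

Lemma accepts_delta A (s : state A) a w :
  accepts s a w = accepts_from (delta s a) w.
Proof. by case: w. Qed.

(** Coalgebra homomorphisms preserve languages. *)
Lemma accepts_from_Gmap A C (f : state A -> state C)
    (fhom : forall x, delta (f x) = Gmap f (delta x)) (h : G Sigma T (state A)) a w :
  accepts_from (Gmap f h a) w <-> accepts_from (h a) w.
Proof.
elim: w h a => [|[p c] w IHw] h a; rewrite /= /Gmap; case: (h a) => [o|[q t]].
- by split=> -[->].
- by [].
- by split=> -[t []].
- have IHt : accepts (f t) c w <-> accepts t c w.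
    by rewrite !accepts_delta fhom.
  split=> -[t' [[-> <-] tw]]; [exists t|exists (f t)]; split=> //; exact/IHt.
Qed.

(** An action is consumed on both sides; outcome 1 of [h] ends the first part of the split and hands
    over to [k] at the same atom. Sequencing uses it with [f] a coproduct injection, loops with [f]
    the identity. *)
Lemma accepts_from_oseq A C (f : state A -> state C) (k : G Sigma T (state C))
    (fk : forall x c, delta (f x) c = oseq (Gmap f (delta x) c) (k c))
    (h : G Sigma T (state A)) a w :
  accepts_from (oseq (Gmap f h a) (k a)) w <->
  exists u v, [/\ w = u ++ v, accepts_from (h a) u
                & accepts_from (k (last a (map snd u))) v].
Proof.
elim: w h a => [|[p c] w IHw] h a.
  split=> [|[[|? ?] [[|? ?] [//= _]]]]; rewrite /= /Gmap; last by move=> ->.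
  case ha: (h a) => [[]|[q t]] //= ka.
  by exists [::], [::].
(* By [fk], the state [f t] has the shape of the induction hypothesis, with [delta t] as the new
   [h]. *)
have IHt t : accepts (f t) c w <-> exists u v,
    [/\ w = u ++ v, accepts t c u & accepts_from (k (last c (map snd u))) v].
  by rewrite accepts_delta fk IHw; split=> -[u [v uv]]; exists u, v; rewrite accepts_delta in uv *.
split=> [|[[|[q d] u] [v [/=]]]].
- rewrite /Gmap; case ha: (h a) => [[]|[q t]] /=.
  + by exists [::], ((p, c) :: w).
  + by case=> t [].
  + move=> [_ [[-> <-]] /IHt[u [v [-> tu kv]]]].
    by exists ((p, c) :: u), v; split=> //=; exists t.
- by move=> <-; rewrite /Gmap => ->.
- move=> [<- <- wE] [t [ha tu]] kv; rewrite /Gmap ha /=.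
  by exists (f t); split=> //; apply/IHt; exists u, v.
Qed.

Lemma pseudo_lang_th_test (b : bexp T) :
  pseudo_lang (th_test Sigma b) = atoms_lang Sigma (bsem b).
Proof.
apply/seteqP; split=> -[a w]; rewrite atoms_langP /pseudo_lang /mkset /=.
  by case: w => [[]|[p c] w [[]]].
by move=> [ab ->] /=; congr inl.
Qed.

Lemma pseudo_lang_th_act (p : Sigma) :
  pseudo_lang (th_act T p) = sem (EAct T p).
Proof.
apply/seteqP; split=> -[a w] /=; rewrite /pseudo_lang /=.
  case: w => [|[q c] [|[r d] w]] //= [t [[<- _]]]; first by exists a, c.
  by case=> ? [].
by move=> [_ [c [_ ->]]] /=; exists tt.
Qed.

Lemma pseudo_lang_th_ite (b : bexp T) (F K : pseudo Sigma T) :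
  pseudo_lang (th_ite b F K) = lite (bsem b) (pseudo_lang F) (pseudo_lang K).
Proof.
have FE := @accepts_from_Gmap (pcoalg F) (pcoalg (th_ite b F K)) inl
             (fun=> erefl) (pinit F).
have KE := @accepts_from_Gmap (pcoalg K) (pcoalg (th_ite b F K)) inr
             (fun=> erefl) (pinit K).
apply/seteqP; split=> -[a w];
  rewrite /lite /setU /mkset !lfuse_atomsl /pseudo_lang /mkset /=; case: ifPn => ab.
- by move/FE; left.
- by move/KE; right; split=> //; exact/negP.
- by move=> [[_]|[]] => [/FE|/(_ ab)].
- by move=> [[]|[_ /KE]] => [/(negP ab)|].
Qed.

Lemma pseudo_lang_th_seq (F K : pseudo Sigma T) :
  pseudo_lang (th_seq F K) = lfuse (pseudo_lang F) (pseudo_lang K).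
Proof.
set S := pcoalg (th_seq F K).
pose il : state (pcoalg F) -> state S := inl.
pose ir : state (pcoalg K) -> state S := inr.
(* Left states lie in [range inl] and continue with [K]; right states do not, so [ir] is a
   homomorphism. *)
have FE : forall x c,
    delta (il x) c = oseq (Gmap il (delta x) c) (Gmap ir (pinit K) c).
  move=> x c; rewrite /= /ucont /= /Gmap.
  by case: (delta x c) => [[]|[]] //=; rewrite mem_set //; exists x.
have KE : forall y, delta (ir y) = Gmap ir (delta y).
  move=> y; apply/funext => c; rewrite /= /ucont /= /Gmap.
  case: (delta y c) => [[]|[]] //=; rewrite memNset //.
  by case.
have initE a : pinit (th_seq F K) a = oseq (Gmap il (pinit F) a) (Gmap ir (pinit K) a).
  by rewrite /= /Gmap; case: (pinit F a) => [[]|[]].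
apply/seteqP; split=> -[a w]; rewrite lfuseP /pseudo_lang /mkset initE
    (accepts_from_oseq FE) /= => -[u [v [-> Fu Kv]]]; exists u, v; split=> //;
  exact/(accepts_from_Gmap KE).
Qed.

Lemma pseudo_lang_th_while (b : bexp T) (F : pseudo Sigma T) :
  pseudo_lang (th_while b F) = lwhile (bsem b) (pseudo_lang F).
Proof.
set W := pcoalg (th_while b F).
pose k := pinit (th_while b F).
pose i : state (pcoalg F) -> state W := id.
have iE : forall x c, delta (i x) c = oseq (Gmap i (delta x) c) (k c).
  move=> x c; rewrite /= /ucont /Gmap /i.
  by case: (delta x c) => [[]|[]] //=; rewrite mem_set.
have kE a : ~~ below a b -> k a = inl true.
  by rewrite /k /= /while_init => /negbTE ->.
(* There is no 1 to override here; the idle [oseq] only gives [k a] the form that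
   [accepts_from_oseq] expects. *)
have bodyE a : below a b -> pinit F a <> inl true ->
    k a = oseq (Gmap i (pinit F) a) (k a).
  rewrite /k /= /while_init /Gmap /i => ->.
  by case: (pinit F a) => [[]|[]].
apply/seteqP; split=> -[a w]; last first.
  (* An iteration with empty [u] stays at the same atom, so the induction hypothesis [kv] is already
     the goal. *)
  move: a w; apply: lwhile_ind => [a /negP /kE //|a [|q u] v ab Fu kv //].
  have ni : pinit F a <> inl true.
    by move=> ia; move: Fu; rewrite /pseudo_lang /= ia; case: q {kv} => p c [t []].
  rewrite -[pseudo_lang _ _]/(accepts_from (k a) ((q :: u) ++ v)) (bodyE _ ab ni).
  by apply/(accepts_from_oseq iE); exists (q :: u), v.
have [n] := ubnP (size w); elim: n a w => // n IHn a w wn.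
rewrite -[pseudo_lang _ _]/(accepts_from (k a) w).
case: (boolP (below a b)) => ab; last first.
  rewrite kE //; case: w wn => [_ _|[p c] w _ [t []] //].
  by apply: lwhile_stop; exact/negP.
(* If the body terminates without acting while the guard holds, [k a] is 0 and nothing is
   accepted. *)
have [ia|ni] := pselect (pinit F a = inl true).
  by rewrite /k /= /while_init ab ia; case: w wn => [|[p c] w] // _ [t []].
rewrite (bodyE _ ab ni) => /(accepts_from_oseq iE)[u [v [wE Fu kv]]].
rewrite wE; apply: lwhile_step => //; apply: IHn => //.
(* By [ni] the body cannot accept the empty word, so [v] is strictly shorter than [w]. *)
case: u wE Fu {kv} => [//|q u] wE _.
by rewrite -ltnS; apply: leq_trans wn; rewrite wE /= size_cat !ltnS leq_addl.
Qed.

Lemma pseudo_lang_thompson (e : exp Sigma T) : pseudo_lang (thompson e) = sem e.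
Proof.
elim: e => [p|b|f IHf g IHg|b f IHf g IHg|b f IHf] /=.
- exact: pseudo_lang_th_act.
- exact: pseudo_lang_th_test.
- by rewrite pseudo_lang_th_seq IHf IHg.
- by rewrite pseudo_lang_th_ite IHf IHg.
- by rewrite pseudo_lang_th_while IHf.
Qed.

End Pseudostates.

Theorem theorem4p1 (Sigma : Type) (T : finType)
  (Sigma_nonempty : inhabited Sigma) (T_nonempty : inhabited T)
  (e : exp Sigma T) :
  lang (start (thompson_automaton e)) = sem e.
Proof.
rewrite -pseudo_lang_thompson.
(* The start state unfolds to the initial pseudostate mapped along [inr], a homomorphism by
   computation. *)
apply/seteqP; split=> -[a w]; rewrite /lang /pseudo_lang /mkset accepts_delta /=;
  by move/(@accepts_from_Gmap _ _ (pcoalg (thompson e)) (thompson_automaton e)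
             inr (fun=> erefl) (pinit (thompson e))).
Qed.
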